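(* There exist uncountably many pairwise non-isomorphic countable torsion groups which have the $R_\infty$ property.
   Context: A group is torsion if every element has finite order. For a group $G$ and $\phi\in\mathrm{Aut}(G)$ (maps written on the right), elements $a,b\in G$ are $\phi$-twisted conjugate if there is $x\in G$ with $(x^{-1})\phi\, a x=b$; the Reidemeister number $R(\phi)$ is the number of $\phi$-twisted conjugacy classes in $G$. $G$ has the $R_\infty$ property if $R(\phi)=\infty$ (infinitely many classes) for every $\phi\in\mathrm{Aut}(G)$. *)

(* Defs.v *)
From mathcomp Require Import all_boot.
From mathcomp Require Import classical_sets cardinality.

Set Implicit Arguments.
Unset Strict Implicit.
Unset Printing Implicit Defensive.

Local Open Scope classical_set_scope.
Local Open Scope group_scope.

Definition torsion (G : groupType) : Prop :=
  forall x : G, exists n : nat, (0 < n)%N /\ x ^+ n = 1.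

Definition twisted_conjugate (G : groupType) (phi : G -> G) (a b : G) : Prop :=
  exists x : G, phi x^-1 * a * x = b.

Definition twisted_class (G : groupType) (phi : G -> G) (a : G) : set G :=
  [set b | twisted_conjugate phi a b].

(* The Reidemeister number R(phi) is the cardinality of this set. *)
Definition twisted_classes (G : groupType) (phi : G -> G) : set (set G) :=
  range (twisted_class phi).

Definition R_infty (G : groupType) : Prop :=
  forall phi : {multiplicative G -> G},
    bijective phi -> infinite_set (twisted_classes phi).

Definition isomorphic (G H : groupType) : Prop :=
  exists f : {multiplicative G -> H}, bijective f.

(* Main.v *)
Require Import Defs.
From HB Require Import structures.
From mathcomp Require Import all_boot ssralg zmodp.
From mathcomp Require Import zify.
From mathcomp Require Import mathcomp_extra boolp classical_sets cardinality.

Set Implicit Arguments.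
Unset Strict Implicit.
Unset Printing Implicit Defensive.

Import GRing.Theory.
Local Open Scope group_scope.

(** For a sequence q of distinct odd primes, let G(q) be the restricted direct
    sum of the dihedral groups D_(q n) of order 2 (q n).  It is countable, and
    it is torsion because its elements have finite support.

    G(q) has the R_infinity property.  Since the q n are distinct odd primes,
    the solutions of x^(q n) = 1 in G(q) are exactly the rotations of the
    n-th factor.  An element g commutes with all of them if and only if its
    n-th coordinate is a rotation ([rotation_centralizes_torsion]).
    Centralizing the q n-torsion is a property preserved by every automorphism
    phi ([centralizes_torsion_aut]), so the homomorphism chi_n : G(q) -> Z/2,
    which tells whether the n-th coordinate is a reflection, satisfies
    chi_n o phi = chi_n.  Hence chi_n (phi(x)^-1 a x) = chi_n a, as the two
    contributions of x cancel modulo 2: each chi_n is constant on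
    phi-twisted classes.  A reflection placed in the m-th factor has
    chi_n = 1 only for n = m, and these elements lie in infinitely many classes
    ([infinite_twisted_classes]).

    An odd prime p is a value of q if and only if G(q) has a nontrivial
    solution of x^p = 1 ([dihedral_sum_primes]), so the isomorphism type of G(q)
    determines the set of values of q.  Given one injective sequence P of odd
    primes, a set S of natural numbers is encoded by the sequence
    n |-> P (2n + [n in S]); its set of values determines S, and there are
    uncountably many S. *)

(** * Twisted classes and invariant characters *)

Lemma multiplicative1 (G H : groupType) (f : {multiplicative G -> H}) : f 1 = 1.
Proof. by apply: (@mulgI _ (f 1)); rewrite -gmulfM !mulg1. Qed.

Lemma multiplicativeX (G H : groupType) (f : {multiplicative G -> H}) x n :
  f (x ^+ n) = f x ^+ n.
Proof.
by elim: n => [|n IHn]; rewrite ?expg0 ?multiplicative1 // !expgS gmulfM IHn.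
Qed.

Definition centralizes_torsion (G : groupType) (p : nat) (g : G) : Prop :=
  forall x : G, x ^+ p = 1 -> commute g x.

(** An automorphism permutes the solutions of [x ^+ p = 1], hence also the
    elements which commute with all of them. *)
Lemma centralizes_torsion_aut (G : groupType) (phi : {multiplicative G -> G}) p g :
  bijective phi -> centralizes_torsion p (phi g) <-> centralizes_torsion p g.
Proof.
move=> phi_bij; have phi_inj := bij_inj phi_bij; case: phi_bij => psi _ psiK.
split=> cent x xp; last first.
  rewrite -[x]psiK; apply/gmulf_commute/cent/phi_inj.
  by rewrite multiplicativeX psiK xp multiplicative1.
apply: phi_inj; rewrite !gmulfM; apply: cent.
by rewrite -multiplicativeX xp multiplicative1.
Qed.

(** Modulo 2 the values of [chi n] at [phi x^-1] and at [x] cancel, so each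
    [chi n] is constant on twisted classes; the classes of the [a m] are told
    apart by their characters. *)
Lemma infinite_twisted_classes (G : groupType) (phi : {multiplicative G -> G})
    (chi : nat -> G -> bool) (a : nat -> G) :
    (forall n, {morph chi n : x y / x * y >-> x (+) y}) ->
    (forall n x, chi n (phi x) = chi n x) ->
    (forall n m, chi n (a m) = (n == m)) ->
  infinite_set (twisted_classes phi).
Proof.
move=> chiM chi_phi chi_a.
have chiV n x : chi n x^-1 = chi n x.
  have chi1 : chi n 1 = false.
    by have := chiM n 1 1; rewrite mulg1; case: (chi n 1).
  by have := chiM n x^-1 x; rewrite mulVg chi1; do 2!case: (chi n _).
have chi_class n x y : twisted_class phi x y -> chi n y = chi n x.
  by case=> z <-; rewrite !chiM chi_phi chiV addbAC addbb.
move=> fin; apply: infinite_nat.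
pose class_of n := twisted_class phi (a n).
rewrite (_ : setT = class_of @^-1` twisted_classes phi)%classic; last first.
  by apply/esym/seteqP; split=> // n _; exists (a n).
apply: finite_preimage fin => m n _ _ eq_mn; apply/eqP; rewrite eq_sym -chi_a.
have : class_of n (a n).
  by exists 1; rewrite invg1 multiplicative1 mul1g mulg1.
by rewrite -eq_mn => /(chi_class n)<-; rewrite chi_a.
Qed.

(** * Restricted direct sums of sequences of groups *)

(** A named copy of the type of dependent functions, so that the pointwise
    group structure is attached to this constant and not to all products. *)
Definition product (D : nat -> groupType) : Type := forall n, D n.

Section Product.
Variable D : nat -> groupType.
Implicit Types f g h : product D.

HB.instance Definition _ := Choice.copy (product D) (forall n, D n).

Let one : product D := fun=> 1.
Let mul f g : product D := fun n => f n * g n.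
Let inv f : product D := fun n => (f n)^-1.

Fact product_mulgA : associative mul.
Proof. by move=> f g h; apply/functional_extensionality_dep => n; exact: mulgA. Qed.
Fact product_mul1g : left_id one mul.
Proof. by move=> f; apply/functional_extensionality_dep => n; exact: mul1g. Qed.
Fact product_mulg1 : right_id one mul.
Proof. by move=> f; apply/functional_extensionality_dep => n; exact: mulg1. Qed.
Fact product_mulVg : left_inverse one inv mul.
Proof. by move=> f; apply/functional_extensionality_dep => n; exact: mulVg. Qed.
Fact product_mulgV : right_inverse one inv mul.
Proof. by move=> f; apply/functional_extensionality_dep => n; exact: mulgV. Qed.

HB.instance Definition _ := isGroup.Build (product D)
  product_mulgA product_mul1g product_mulg1 product_mulVg product_mulgV.

Definition finitely_supported : {pred product D} :=
  fun f => `[< exists N, forall n, (N <= n)%N -> f n = 1 >].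

Fact finitely_supported_group_closed : group_closed finitely_supported.
Proof.
split; first by apply/asboolP; exists 0%N.
move=> f g /asboolP[N fN] /asboolP[M gM]; apply/asboolP; exists (maxn N M) => n.
rewrite geq_max => /andP[/fN fn /gM gn]; change (f n / g n = 1).
by rewrite fn gn divg1.
Qed.

Record direct_sum := DirectSum
  { coord : product D; coordP : coord \in finitely_supported }.

HB.instance Definition _ := [isSub of direct_sum for coord].
HB.instance Definition _ := [Choice of direct_sum by <:].
HB.instance Definition _ := SubChoice_isSubGroup.Build _ _ direct_sum
  finitely_supported_group_closed.

Implicit Types x y : direct_sum.

Lemma coordM x y n : coord (x * y) n = coord x n * coord y n. Proof. by []. Qed.
Lemma coordX x k n : coord (x ^+ k) n = coord x n ^+ k.
Proof. by elim: k => // k IHk; rewrite !expgS coordM IHk. Qed.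

Lemma direct_sumP x y : (forall n, coord x n = coord y n) -> x = y.
Proof. by move=> xy; apply/val_inj/functional_extensionality_dep. Qed.

Fact single_subproof n (d : D n) :
  dfwith (fun m => 1 : D m) n d \in finitely_supported.
Proof.
apply/asboolP; exists n.+1 => m lt_nm.
by rewrite dfwithout // ltn_eqF.
Qed.
Definition single n (d : D n) := DirectSum (single_subproof d).

Lemma single_in n (d : D n) : coord (single d) n = d. Proof. exact: dfwithin. Qed.
Lemma single_out n (d : D n) m : n != m -> coord (single d) m = 1.
Proof. exact: dfwithout. Qed.

Lemma direct_sum_torsion : (forall n, torsion (D n)) -> torsion direct_sum.
Proof.
move=> torD x; have /asboolP[N xN] := coordP x.
(* Coordinates beyond N are trivial, so a common exponent is needed only
   for the first N; multiply the exponents of the coordinates. *)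
suff [k k_gt0 xk] : exists2 k, (0 < k)%N & forall n, (n < N)%N -> coord x n ^+ k = 1.
  exists k; split=> //; apply: direct_sumP => n; rewrite coordX.
  by have [/xk|/xN->] := ltnP n N; rewrite ?expg1n.
elim: {xN}N => [|N [k k_gt0 xk]]; first by exists 1%N.
have [l [l_gt0 xl]] := torD N (coord x N).
exists (k * l)%N => [|n]; first by rewrite muln_gt0 k_gt0.
rewrite ltnS leq_eqVlt => /predU1P[->|/xk xnk].
  by rewrite mulnC expgnA xl expg1n.
by rewrite expgnA xnk expg1n.
Qed.

(** An element is coded by the list of the codes of its coordinates up to a
    bound for its support; the length of the list recovers the bound. *)
Lemma direct_sum_countable (c : forall n, D n -> nat) :
  (forall n, injective (c n)) -> countable [set: direct_sum].
Proof.
move=> c_inj.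
have bound x : {N | forall n, (N <= n)%N -> coord x n = 1}.
  by apply: cid; apply/asboolP/coordP.
pose code x := pickle (mkseq (fun n => c n (coord x n)) (sval (bound x))).
apply/countable_injP; exists code => x y _ _ /(pcan_inj pickleK) eq_xy.
have eqN : sval (bound x) = sval (bound y).
  by move/(congr1 size): eq_xy; rewrite !size_mkseq.
apply: direct_sumP => n; have [ltnN|leNn] := ltnP n (sval (bound x)); last first.
  by rewrite (svalP (bound x)) // (svalP (bound y)) // -eqN.
apply: c_inj; move/(congr1 (nth 0%N ^~ n)): eq_xy.
by rewrite !nth_mkseq -?eqN.
Qed.

End Product.

(** * Generalized dihedral groups *)

(** The semidirect product of [A] by Z/2 acting by inversion: [(a, false)] is the
    map t |-> a + t and [(a, true)] the map t |-> a - t. *)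
Definition dihedral (A : zmodType) : Type := (A * bool)%type.

Section Dihedral.
Variable A : zmodType.

HB.instance Definition _ := Choice.copy (dihedral A) (A * bool)%type.

Let sgn (e : bool) (a : A) : A := (if e then - a else a)%R.
Let mul (x y : dihedral A) : dihedral A := ((x.1 + sgn x.2 y.1)%R, x.2 (+) y.2).
Let inv (x : dihedral A) : dihedral A := ((- sgn x.2 x.1)%R, x.2).

Fact dihedral_mulgA : associative mul.
Proof.
move=> [a e] [b f] [c g]; rewrite /mul /= addbA; congr (_, _).
by case: e; case: f; rewrite /= ?opprD ?opprK addrA.
Qed.
Fact dihedral_mul1g : left_id ((0%R, false) : dihedral A) mul.
Proof. by move=> [a e]; rewrite /mul /= add0r. Qed.
Fact dihedral_mulg1 : right_id ((0%R, false) : dihedral A) mul.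
Proof. by move=> [a []]; rewrite /mul /= ?oppr0 addr0. Qed.
Fact dihedral_mulVg : left_inverse ((0%R, false) : dihedral A) inv mul.
Proof. by move=> [a []]; rewrite /mul /inv /= ?opprK ?subrr ?addNr. Qed.
Fact dihedral_mulgV : right_inverse ((0%R, false) : dihedral A) inv mul.
Proof. by move=> [a []]; rewrite /mul /inv /= ?opprK subrr. Qed.

HB.instance Definition _ := isGroup.Build (dihedral A)
  dihedral_mulgA dihedral_mul1g dihedral_mulg1 dihedral_mulVg dihedral_mulgV.

Definition rotation (a : A) : dihedral A := (a, false).
Definition reflection (a : A) : dihedral A := (a, true).
Definition is_reflection (x : dihedral A) : bool := x.2.

Lemma rotationX a k : rotation a ^+ k = rotation (a *+ k)%R.
Proof. by elim: k => // k IHk; rewrite expgS IHk mulrS. Qed.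

Lemma reflection2 x : is_reflection x -> x ^+ 2 = 1.
Proof. by case: x => a [] // _; rewrite expg2; congr (_, _); rewrite /= subrr. Qed.

Lemma reflection_odd x p : is_reflection x -> odd p -> x ^+ p = x.
Proof.
move=> xr p_odd; rewrite -(odd_double_half p) p_odd -muln2 mulnC expgnDr expgnA.
by rewrite reflection2 // expg1n mulg1.
Qed.

Lemma rotation_commute x y : ~~ is_reflection x -> ~~ is_reflection y -> commute x y.
Proof. by case: x y => [a []] [b []] // _ _; congr (_, _); exact: addrC. Qed.

(** A reflection conjugates each rotation to its inverse, so it commutes only
    with those of order at most 2. *)
Lemma reflection_rotation_commute x a :
  is_reflection x -> commute x (rotation a) -> (a *+ 2 = 0)%R.
Proof.
case: x => b [] // _ [] /=; rewrite [(a + b)%R]addrC => /addrI Na.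
by rewrite mulr2n -{1}Na addNr.
Qed.

End Dihedral.

Section PrimeDihedral.
Variable q : nat.
Hypothesis q_prime : prime q.

Lemma dihedral_exponent (x : dihedral 'F_q) : x ^+ (2 * q) = 1.
Proof.
have [/reflection2 x2|] := boolP (is_reflection x).
  by rewrite expgnA x2 expg1n.
case: x => a [] // _.
by rewrite rotationX mulrnA -mulr_natr pchar_Fp_0 ?mulr0.
Qed.

(** Reflections are involutions, so they are their own odd powers and never
    killed by [p]; the rotations form a group of order [q]. *)
Lemma dihedral_odd_torsion p (x : dihedral 'F_q) : prime p -> odd p ->
  x ^+ p = 1 -> ~~ is_reflection x /\ (x <> 1 -> p = q).
Proof.
move=> p_prime p_odd xp1.
have Nxr : ~~ is_reflection x.
  by apply/negP => xr; have := xr; rewrite -(reflection_odd xr p_odd) xp1.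
split=> // xn1; case: x Nxr xn1 xp1 => a [] // _ an0.
rewrite rotationX => -[] /eqP; rewrite -mulr_natr mulf_eq0 => /predU1P[a0|].
  by case: an0; rewrite a0.
by rewrite -(dvdn_pcharf (pchar_Fp q_prime)) dvdn_prime2 // => /eqP->.
Qed.

End PrimeDihedral.

(** * Sums of dihedral groups over a sequence of odd primes *)

Definition dihedral_sum (q : nat -> nat) : groupType :=
  direct_sum (fun n => dihedral 'F_(q n)).

Section DihedralSum.
Variable q : nat -> nat.
Hypotheses (q_prime : forall n, prime (q n)) (q_odd : forall n, odd (q n)).

Let G := dihedral_sum q.

Lemma dihedral_sum_torsion : torsion G.
Proof.
apply: direct_sum_torsion => n x; exists (2 * q n)%N.
split; first by rewrite muln_gt0 /=; exact: prime_gt0.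
exact: dihedral_exponent.
Qed.

Lemma dihedral_sum_countable : countable [set: G].
Proof.
pose code n (x : dihedral 'F_(q n)) := pickle (x : 'F_(q n) * bool).
have code_inj n : injective (code n) by exact: (pcan_inj pickleK).
exact: direct_sum_countable code_inj.
Qed.

(** The right-hand side is an isomorphism invariant, so the group determines
    which odd primes occur in the sequence. *)
Lemma dihedral_sum_primes p : prime p -> odd p ->
  (exists n, p = q n) <-> (exists x : G, x <> 1 /\ x ^+ p = 1).
Proof.
move=> p_prime p_odd; split=> [[n ->]|[x [xn1 xp1]]].
  exists (single (rotation (1%R : 'F_(q n)))); split.
    move/(congr1 (fun x : G => (coord x n).1)); rewrite single_in.
    by move/eqP; rewrite oner_eq0.
  apply: direct_sumP => m; rewrite coordX; have [<-|nm] := eqVneq n m.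
    by rewrite single_in rotationX pchar_Fp_0.
  by rewrite single_out // expg1n.
have [n xn] : exists n, coord x n <> 1.
  by apply/existsNP => x1; apply/xn1/direct_sumP.
have xnp : coord x n ^+ p = 1 by rewrite -coordX xp1.
by exists n; have [_ ->] := dihedral_odd_torsion (q_prime n) p_prime p_odd xnp.
Qed.

Hypothesis q_inj : injective q.

(** Since [q] is injective, the solutions of [y ^+ q n = 1] are the rotations of
    the [n]-th factor.  Rotations commute with them, while a reflection inverts
    the generator, whose order is odd.  This describes the [n]-th
    reflection character in purely group-theoretic terms. *)
Lemma rotation_centralizes_torsion (x : G) n :
  centralizes_torsion (q n) x <-> ~~ is_reflection (coord x n).
Proof.
split=> [cent|xr y yq].
  apply/negP => xr.
  have /(congr1 (fun y : G => coord y n)) :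
      commute x (single (rotation (1%R : 'F_(q n)))).
    apply: cent; apply: direct_sumP => m; rewrite coordX.
    have [<-|nm] := eqVneq n m; first by rewrite single_in rotationX pchar_Fp_0.
    by rewrite single_out // expg1n.
  rewrite !coordM single_in => /(reflection_rotation_commute xr)/eqP.
  rewrite -(dvdn_pcharf (pchar_Fp (q_prime n))) dvdn_prime2 // => /eqP q2.
  by have := q_odd n; rewrite q2.
apply: direct_sumP => m; rewrite !coordM.
have ym : coord y m ^+ q n = 1 by rewrite -coordX yq.
have [Nyr ym1] := dihedral_odd_torsion (q_prime m) (q_prime n) (q_odd n) ym.
have [->|/eqP/ym1/q_inj nm] := eqVneq (coord y m) 1; first by rewrite mul1g mulg1.
by apply: rotation_commute Nyr; rewrite -nm.
Qed.

Lemma dihedral_sum_R_infty : R_infty G.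
Proof.
move=> phi phi_bij.
apply: (@infinite_twisted_classes _ _ (fun n x => is_reflection (coord x n))
  (fun n => single (reflection (0%R : 'F_(q n))))).
- by [].
- move=> n x; apply: negb_inj; apply/idP/idP => /rotation_centralizes_torsion cent.
    by apply/rotation_centralizes_torsion/(centralizes_torsion_aut _ _ phi_bij).
  by apply/rotation_centralizes_torsion/centralizes_torsion_aut.
- move=> n m; have [->|nm] := eqVneq n m; first by rewrite single_in.
  by rewrite single_out 1?eq_sym.
Qed.

End DihedralSum.

(** * Uncountably many sequences of odd primes *)

Lemma odd_prime_sequence :
  exists P : nat -> nat,
    [/\ injective P, forall n, prime (P n) & forall n, odd (P n)].
Proof.
pose next m := s2val (prime_above m).
pose P n := iter n.+1 next 2.
have P_lt n : (P n < P n.+1)%N by exact: (s2valP (prime_above _)).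
have P_mono : {homo P : m n / (m < n)%N}.
  by apply: homo_ltn => // ? ? ?; exact: ltn_trans.
have P_prime n : prime (P n) by exact: (s2valP' (prime_above _)).
exists P; split=> // [m n eqP|n].
  by have [/P_mono|/P_mono|//] := ltngtP m n; rewrite eqP ltnn.
have [Pn2|//] := even_prime (P_prime n); suff : (2 < P n)%N by rewrite Pn2.
have P0 : (2 < P 0)%N by exact: (s2valP (prime_above _)).
by case: n {Pn2} => // n; apply: ltn_trans P0 _; apply: P_mono.
Qed.

Lemma set_nat_uncountable : ~ countable [set: set nat].
Proof.
move=> /countable_injP[f f_inj].
pose diag : set nat := fun n => exists2 S, f S = n & ~ S n.
have Ndiag : ~ diag (f diag).
  move=> diag_f; case: (diag_f) => S eqf; apply.
  by rewrite (f_inj S diag) ?in_setE.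
by apply: (Ndiag); exists diag.
Qed.

Local Open Scope classical_set_scope.

Theorem corollary3p11 :
  exists (I : Type) (G : I -> groupType),
    [/\ ~ countable [set: I],
        forall i j : I, i <> j -> ~ isomorphic (G i) (G j)
      & forall i : I,
          [/\ countable [set: G i], torsion (G i) & R_infty (G i)]].
Proof.
have [P [P_inj P_prime P_odd]] := odd_prime_sequence.
(* Index 2n or 2n+1 according to membership of n: every S yields an infinite
   sequence, and distinct S yield distinct sets of primes. *)
pose q (S : set nat) n := P (2 * n + `[< S n >])%N.
have q_prime S n : prime (q S n) by exact: P_prime.
have q_odd S n : odd (q S n) by exact: P_odd.
have q_inj2 S T m n : q S m = q T n -> m = n /\ `[< S m >] = `[< T n >].
  move/P_inj; do 2!case: asbool; lia.
exists (set nat), (fun S => dihedral_sum (q S)); split.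
- exact: set_nat_uncountable.
- move=> S T neqST [f f_bij]; apply: neqST.
  have f_inj := bij_inj f_bij.
  apply/seteqP; suff sub n : `[< S n >] = `[< T n >].
    by split=> n /asboolP; [rewrite sub|rewrite -sub] => /asboolP.
  have [x [xn1 xp]] : exists x : dihedral_sum (q S), x <> 1 /\ x ^+ q S n = 1.
    by apply/(dihedral_sum_primes (q_prime S)) => //; exists n.
  have : exists y : dihedral_sum (q T), y <> 1 /\ y ^+ q S n = 1.
    exists (f x); split=> [fx1|]; last first.
      by rewrite -multiplicativeX xp multiplicative1.
    by apply/xn1/f_inj; rewrite multiplicative1.
  by case/(dihedral_sum_primes (q_prime T)) => // m /q_inj2[<-].
- move=> S; split.
  + exact: dihedral_sum_countable.
  + exact: dihedral_sum_torsion.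
  + by apply: dihedral_sum_R_infty => // m n /q_inj2[].
Qed.
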